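(* Let $ABCD$ be a cyclic quadrilateral in the Euclidean plane with four distinct vertices on a circle $\Gamma$, and let $\Sigma$ be a (non-degenerate) rectangular hyperbola passing through $A,B,C,D$. Let $P$ be a point of $\Sigma$ different from $A,B,C,D$ and different from the orthocentres of the triangles $\Delta_1=BCD$, $\Delta_2=ACD$, $\Delta_3=ABD$, $\Delta_4=ABC$. For $k=1,2,3,4$ let $\Gamma_k$ be the Hagge circle of $P$ with respect to $\Delta_k$, and let the points $A_k,A_k',B_k,B_k',C_k,C_k',D_k,D_k'$ of $\Gamma_k$ be defined as in the context. Then the eight points $A_1,A_2,A_3,A_4,A_1',A_2',A_3',A_4'$ are collinear; likewise the eight points $B_k,B_k'$ $(k=1,2,3,4)$ are collinear, the eight points $C_k,C_k'$ $(k=1,2,3,4)$ are collinear, and the eight points $D_k,D_k'$ $(k=1,2,3,4)$ are collinear.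
   Context: A rectangular hyperbola is a hyperbola whose asymptotes are perpendicular. Convention on second intersections: if a line through a point $S$ of a circle is tangent to the circle at $S$, its second intersection with the circle is $S$ itself. Let $A',B',C',D'$ be the second intersections of the lines $AP,BP,CP,DP$ with $\Gamma$. The circumcircle of each $\Delta_k$ is $\Gamma$. Hagge circle: for each $k$ and each vertex $X\in\{A,B,C,D\}$ of $\Delta_k$, let $X_k'$ be the reflection of $X'$ in the side line of $\Delta_k$ opposite to $X$ (for example $A_4'$, $B_4'$, $C_4'$ are the reflections of $A'$ in $BC$, of $B'$ in $CA$, of $C'$ in $AB$). The Hagge circle $\Gamma_k$ of $P$ with respect to $\Delta_k$ is the circle through these three points $X_k'$; it is known that it passes through the orthocentre of $\Delta_k$. For each vertex $X$ of $\Delta_k$, let $X_k$ be the second intersection of the line $X_k'P$ with $\Gamma_k$ (the first being $X_k'$). For the one point $X\in\{A,B,C,D\}$ that is not a vertex of $\Delta_k$ (i.e. $X=A,B,C,D$ for $k=1,2,3,4$ respectively), let $X_k$ be the orthocentre of $\Delta_k$, and let $X_k'$ be the second intersection of the line $X_kP$ with $\Gamma_k$ (the first being $X_k$). Thus $A_1,B_2,C_3,D_4$ are the orthocentres of $BCD,ACD,ABD,ABC$. *)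

(* Defs.v *)
(* The Euclidean plane is R * R, over the reals of Stdlib. *)
From Stdlib Require Import Reals List.
Open Scope R_scope.

Definition point : Type := (R * R)%type.

Definition padd (X Y : point) : point := (fst X + fst Y, snd X + snd Y).
Definition psub (X Y : point) : point := (fst X - fst Y, snd X - snd Y).
Definition pscale (t : R) (X : point) : point := (t * fst X, t * snd X).
Definition dot (X Y : point) : R := fst X * fst Y + snd X * snd Y.
Definition midpoint (X Y : point) : point := pscale (1 / 2) (padd X Y).

(* A line only when [S <> T]. *)
Definition line_through (S T X : point) : Prop :=
  exists t : R, X = padd S (pscale t (psub T S)).

Definition perpendicular (S T S' T' : point) : Prop :=
  dot (psub T S) (psub T' S') = 0.

(* The points of a collinear set need not be distinct. *)
Definition collinear (E : point -> Prop) : Prop :=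
  exists S T : point, S <> T /\ forall X : point, E X -> line_through S T X.

Record circle : Type := Circle {
  center : point;
  radius : R;
  radius_pos : 0 < radius
}.

Definition on_circle (c : circle) (X : point) : Prop :=
  dot (psub X (center c)) (psub X (center c)) = (radius c) ^ 2.

(* For [S] on [c] and [T <> S].  The last clause says that [S] itself is allowed
   only when the line [ST] is tangent to [c] at [S]. *)
Definition second_intersection (c : circle) (S T S' : point) : Prop :=
  line_through S T S' /\ on_circle c S' /\
  (S' = S -> perpendicular (center c) S S T).

Definition is_reflection (S T X X' : point) : Prop :=
  line_through S T (midpoint X X') /\ perpendicular S T X X'.

Definition is_orthocentre (X Y Z H : point) : Prop :=
  perpendicular X H Y Z /\ perpendicular Y H Z X /\ perpendicular Z H X Y.

(* In the orthonormal frame [(hcenter, axis1, axis2)] the equation is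
   x^2 / semi1^2 - y^2 / semi2^2 = 1, so degenerate conics are excluded. *)
Record hyperbola : Type := Hyperbola {
  hcenter : point;
  axis1 : point;
  axis2 : point;
  semi1 : R;
  semi2 : R;
  axis1_unit : dot axis1 axis1 = 1;
  axis2_unit : dot axis2 axis2 = 1;
  axes_orthogonal : dot axis1 axis2 = 0;
  semi1_pos : 0 < semi1;
  semi2_pos : 0 < semi2
}.

Definition on_hyperbola (h : hyperbola) (X : point) : Prop :=
  let x := dot (psub X (hcenter h)) (axis1 h) in
  let y := dot (psub X (hcenter h)) (axis2 h) in
  x ^ 2 / (semi1 h) ^ 2 - y ^ 2 / (semi2 h) ^ 2 = 1.

(* The asymptotes, y = (semi2 / semi1) x and y = - (semi2 / semi1) x in the frame
   above, join the centre to these two points. *)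
Definition asymptote_point1 (h : hyperbola) : point :=
  padd (hcenter h)
    (padd (pscale (semi1 h) (axis1 h)) (pscale (semi2 h) (axis2 h))).
Definition asymptote_point2 (h : hyperbola) : point :=
  padd (hcenter h)
    (psub (pscale (semi1 h) (axis1 h)) (pscale (semi2 h) (axis2 h))).

Definition rectangular (h : hyperbola) : Prop :=
  perpendicular (hcenter h) (asymptote_point1 h)
                (hcenter h) (asymptote_point2 h).

(* The labels of the vertices of the quadrilateral.  A label also names the
   triangle of the three other vertices: [lA] names BCD, [lB] names ACD, [lC]
   names ABD and [lD] names ABC. *)
Inductive label : Type := lA | lB | lC | lD.

(* [X] is a vertex of the triangle [k], with opposite side joining the vertices
   [Y] and [Z]. *)
Definition vertex_opposite (k X Y Z : label) : Prop :=
  NoDup (k :: X :: Y :: Z :: nil).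

(* Main.v *)
Require Import Defs.
From Stdlib Require Import Reals Lra List.
From Coquelicot Require Import Complex.
Open Scope R_scope.

(** Fix the label [A].  The points [A_2'], [A_3'], [A_4'] are the reflections of
    the single point [A'] of the circle in the three sides of the triangle [BCD],
    so they lie on the Steiner line of [A'] with respect to [BCD], which also
    contains the orthocentre [A_1] of [BCD].  The heart of the matter is that [P]
    lies on this Steiner line too ([point_on_Steiner_line]).  The eight points are
    then all on the line [P A_1]: each [A_k] is on the line [A_k' P], and [A_1'] is
    on the line [A_1 P].

    The key fact is a computation with complex numbers, the origin being the
    centre of the circle, whose squared radius is [k].  Write a bar for the
    conjugate, and [s1, .., s4] and [e1, e2, e3] for the elementary symmetric
    functions of [a, b, c, d] and of [b, c, d].

    - A rectangular hyperbola has an equation without [z * bar z] term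
      ([rectangular_hyperbola_conic]).  On the circle, [bar z = k / z] turns it into
      a quartic with roots [a, b, c, d], and Vieta's formulas leave only one such
      hyperbola ([rectangular_hyperbola_cyclic]):
      [k^2 z^2 + s4 (bar z)^2 - k^2 s1 z - k s3 (bar z) + k^2 s2 = 0].
    - The orthocentre of [BCD] is [h = e1] and the reflection of [A'] in [BC] is
      [b + c - b c / a'].  From these the Steiner line of [A'] has the equation
      [k a' (z - h) = e3 (bar z) - k e2].
    - As [A'] is on the line [AP], [a' (a (bar p) - k) = k (a - p)].  Multiplying
      the equation of the Steiner line at [p] by [a (bar p) - k], which is nonzero
      as [P] is not [A], gives exactly the equation of the hyperbola at [p]. *)

(** * Points as complex numbers *)

(** The complex coordinate of [X] when the origin is the centre of [c]: on the
    circle, conjugation becomes the rational map [z -> radius2 c / z]. *)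
Definition affix (c : circle) (X : point) : C := Cminus X (center c).
Definition radius2 (c : circle) : C := RtoC (radius c ^ 2).

Lemma Cconj_RtoC (t : R) : Cconj (RtoC t) = RtoC t.
Proof. unfold Cconj, RtoC; simpl; now rewrite Ropp_0. Qed.

Lemma Ceq_of_minus (x y : C) : (x - y = 0)%C -> x = y.
Proof. intro H. apply Ceq_minus; exact H. Qed.

Lemma Cmult_cancel (a x y : C) : a <> 0%C -> (a * x = a * y)%C -> x = y.
Proof.
  intros Ha H.
  replace x with (/ a * (a * x))%C by (field; exact Ha).
  rewrite H; field; exact Ha.
Qed.

Lemma RtoC_neq_0 (t : R) : t <> 0 -> RtoC t <> 0%C.
Proof. intros Ht H; apply Ht; exact (f_equal fst H). Qed.

Lemma RtoC_dot (u v : C) :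
  (RtoC 2 * RtoC (dot u v) = u * Cconj v + Cconj u * v)%C.
Proof.
  destruct u, v; unfold dot, Cconj, Cmult, Cplus, RtoC; simpl.
  apply injective_projections; simpl; ring.
Qed.

Lemma dot_self (u : C) : RtoC (dot u u) = (u * Cconj u)%C.
Proof.
  apply (Cmult_cancel (RtoC 2)); [apply RtoC_neq_0, Rgt_not_eq, Rlt_0_2 |].
  rewrite RtoC_dot; ring.
Qed.

Lemma dot_eq_0 (u v : C) : dot u v = 0 -> (u * Cconj v + Cconj u * v = 0)%C.
Proof. intro H. rewrite <- RtoC_dot, H. ring. Qed.

Lemma pscale_mult (t : R) (u : C) : pscale t u = (RtoC t * u)%C.
Proof.
  destruct u; unfold pscale, Cmult, RtoC; simpl.
  apply injective_projections; simpl; ring.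
Qed.

(** [point] and [C] are convertible, but [ring] finds its structure by the name of
    the type; subtracting the two sides moves the equation to [C]. *)
Ltac complex_ring :=
  apply Ceq_of_minus; ring.

Lemma line_through_C (S T X : point) :
  line_through S T X <-> exists t : R, X = (S + RtoC t * Cminus T S)%C.
Proof.
  split; intros [t Ht]; exists t; rewrite Ht.
  - rewrite pscale_mult; reflexivity.
  - rewrite <- pscale_mult; reflexivity.
Qed.

Lemma line_through_swap (S T X : point) :
  line_through S T X -> line_through T S X.
Proof.
  rewrite !line_through_C. intros [t ->]. exists (1 - t).
  rewrite RtoC_minus. complex_ring.
Qed.

Lemma line_through_chain (S T U X : point) :
  line_through S T U -> line_through U S X -> line_through S T X.
Proof.
  rewrite !line_through_C. intros [t ->] [u ->]. exists (t - u * t).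
  rewrite RtoC_minus, RtoC_mult. complex_ring.
Qed.

(** The hypothesis says that [(X - S) / (T - S)] is its own conjugate; being real,
    this quotient is the parameter of [X] on the line. *)
Lemma line_through_of_real_ratio (S T X : point) :
  S <> T ->
  (Cminus X S * Cconj (Cminus T S) = Cconj (Cminus X S) * Cminus T S)%C ->
  line_through S T X.
Proof.
  intros HST H. set (v := Cminus T S) in *. set (u := Cminus X S) in *.
  assert (Hv : v <> 0%C).
  { intro E. apply HST. symmetry. apply Ceq_of_minus. exact E. }
  assert (Hn : dot v v <> 0).
  { intro E. apply Hv. destruct v as [x y]; unfold dot in E; simpl in E.
    destruct (Rplus_sqr_eq_0 _ _ E) as [-> ->]; reflexivity. }
  assert (Huv : RtoC (dot u v) = (u * Cconj v)%C).
  { apply (Cmult_cancel (RtoC 2)); [apply RtoC_neq_0, Rgt_not_eq, Rlt_0_2 |].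
    rewrite RtoC_dot, <- H. ring. }
  assert (Hvv : (v * Cconj v)%C <> 0%C).
  { rewrite <- dot_self. apply RtoC_neq_0; exact Hn. }
  assert (Hv' : Cconj v <> 0%C).
  { intro E. apply Hvv. rewrite E. ring. }
  apply line_through_C. exists (dot u v / dot v v).
  rewrite RtoC_div, Huv, dot_self by exact Hn.
  fold v. replace (S + u * Cconj v / (v * Cconj v) * v)%C with (S + u)%C
    by (field; split; assumption).
  unfold u; complex_ring.
Qed.

(** * Chords of a circle *)

Lemma affix_inj (c : circle) (X Y : point) : affix c X = affix c Y -> X = Y.
Proof.
  unfold affix; intro H. apply Ceq_of_minus.
  replace (X - Y)%C with (Cminus X (center c) - Cminus Y (center c))%C by ring.
  rewrite H; ring.
Qed.

Lemma radius2_neq_0 (c : circle) : radius2 c <> 0%C.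
Proof.
  apply RtoC_neq_0, Rgt_not_eq, pow_lt, radius_pos.
Qed.

Lemma on_circle_affix (c : circle) (X : point) :
  on_circle c X -> (affix c X * Cconj (affix c X) = radius2 c)%C.
Proof.
  intro H. unfold radius2. rewrite <- H, <- dot_self. reflexivity.
Qed.

Lemma affix_neq_0 (c : circle) (X : point) : on_circle c X -> affix c X <> 0%C.
Proof.
  intros H E. apply (radius2_neq_0 c).
  rewrite <- (on_circle_affix c X H), E. ring.
Qed.

Lemma conj_affix (c : circle) (X : point) :
  on_circle c X -> Cconj (affix c X) = (radius2 c / affix c X)%C.
Proof.
  intro H. rewrite <- (on_circle_affix c X H).
  field. exact (affix_neq_0 c X H).
Qed.

(** The equation of the line [ST] with the conjugates of [s] and [t] eliminated.  It
    holds at both endpoints and is real-affine in the coordinate of [X], hence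
    holds along the line. *)
Lemma line_through_chord (c : circle) (S T X : point) :
  on_circle c S -> on_circle c T -> line_through S T X ->
  (radius2 c * affix c X + affix c S * affix c T * Cconj (affix c X)
   = radius2 c * (affix c S + affix c T))%C.
Proof.
  intros HS HT HX. apply line_through_C in HX. destruct HX as [t ->].
  replace (affix c (S + RtoC t * Cminus T S)%C)
    with (affix c S + RtoC t * (affix c T - affix c S))%C by (unfold affix; ring).
  rewrite Cplus_conj, Cmult_conj, Cminus_conj, Cconj_RtoC.
  rewrite (conj_affix c S HS), (conj_affix c T HT).
  field. split; [exact (affix_neq_0 c S HS) | exact (affix_neq_0 c T HT)].
Qed.

(** A chord direction satisfies [conj (t - s) = - k (t - s) / (s t)], with [k] the
    squared radius; a vector perpendicular to it has the opposite sign. *)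
Lemma perpendicular_chord (c : circle) (S T X Y : point) :
  on_circle c S -> on_circle c T -> S <> T -> perpendicular S T X Y ->
  (radius2 c * (affix c Y - affix c X)
   = affix c S * affix c T * Cconj (affix c Y - affix c X))%C.
Proof.
  intros HS HT HST H. apply dot_eq_0 in H.
  change (psub T S) with (Cminus T S) in H.
  change (psub Y X) with (Cminus Y X) in H.
  replace (Cminus T S) with (affix c T - affix c S)%C in H by (unfold affix; ring).
  replace (Cminus Y X) with (affix c Y - affix c X)%C in H by (unfold affix; ring).
  set (w := (affix c Y - affix c X)%C) in *.
  rewrite Cminus_conj, (conj_affix c S HS), (conj_affix c T HT) in H.
  pose proof (affix_neq_0 c S HS) as Hs. pose proof (affix_neq_0 c T HT) as Ht.
  apply (Cmult_cancel (affix c T - affix c S)).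
  { intro E. apply HST. symmetry. apply (affix_inj c), Ceq_of_minus; exact E. }
  apply Ceq_of_minus.
  transitivity (- (affix c S * affix c T) * 0)%C; [| ring].
  rewrite <- H. field. split; assumption.
Qed.

(** The chord equation with the point [T] of the line known and the endpoint [S']
    sought.  When [S' = S] it becomes the equation of the tangent at [S], which is
    what the convention on tangent lines provides, so no case distinction is left
    in the conclusion. *)
Lemma second_intersection_chord (c : circle) (S T S' : point) :
  on_circle c S -> second_intersection c S T S' ->
  (radius2 c * affix c T + affix c S * affix c S' * Cconj (affix c T)
   = radius2 c * (affix c S + affix c S'))%C.
Proof.
  intros HS [HL [HS' Htan]].
  destruct (Ceq_dec S' S) as [E | HN].
  - specialize (Htan E). subst S'. apply dot_eq_0 in Htan.
    change (psub S (center c)) with (affix c S) in Htan.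
    change (psub T S) with (Cminus T S) in Htan.
    replace (Cminus T S) with (affix c T - affix c S)%C in Htan by (unfold affix; ring).
    rewrite Cminus_conj, (conj_affix c S HS) in Htan.
    pose proof (affix_neq_0 c S HS) as Hs.
    apply Ceq_of_minus. transitivity (affix c S * 0)%C; [| ring].
    rewrite <- Htan. field. exact Hs.
  - apply line_through_chord; [exact HS | exact HS' |].
    apply line_through_C in HL. destruct HL as [t Ht].
    assert (Hn : t <> 0).
    { intro E. apply HN. rewrite Ht, E. ring. }
    apply line_through_C. exists (/ t). rewrite Ht, RtoC_inv by exact Hn.
    apply RtoC_neq_0 in Hn. apply Ceq_of_minus. field. exact Hn.
Qed.

(** The midpoint of [X X'] satisfies the equation of the chord [YZ], and [X' - X] is
    perpendicular to that chord; the first equation plus half the second eliminates the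
    coordinate of [X] and the conjugate of that of [X']. *)
Lemma reflection_chord (c : circle) (Y Z X X' : point) :
  on_circle c Y -> on_circle c Z -> Y <> Z -> is_reflection Y Z X X' ->
  (radius2 c * affix c X' + affix c Y * affix c Z * Cconj (affix c X)
   = radius2 c * (affix c Y + affix c Z))%C.
Proof.
  intros HY HZ HYZ [HM HP].
  pose proof (line_through_chord c Y Z _ HY HZ HM) as HM'.
  pose proof (perpendicular_chord c Y Z X X' HY HZ HYZ HP) as HP'.
  replace (affix c (midpoint X X'))
    with (RtoC (1 / 2) * (affix c X + affix c X'))%C in HM'.
  2: { unfold midpoint, affix. rewrite pscale_mult.
       change (padd X X') with (Cplus X X').
       unfold Rdiv; rewrite Rmult_1_l, RtoC_inv by discrR.
       field. }
  rewrite Cmult_conj, Cplus_conj, Cconj_RtoC in HM'.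
  unfold Rdiv in HM'; rewrite Rmult_1_l, RtoC_inv in HM' by discrR.
  rewrite Cminus_conj in HP'.
  apply Ceq_minus in HM'.
  apply Ceq_minus in HP'.
  apply Ceq_of_minus.
  match type of HM' with ?e = _ =>
  match type of HP' with ?f = _ =>
    transitivity (e + f / RtoC 2)%C; [field | rewrite HM', HP'; field]
  end end.
Qed.

(** Two altitudes give linear equations in the coordinate of [H] and its conjugate;
    eliminating the conjugate leaves a factor [y - x], nonzero for distinct
    vertices. *)
Lemma orthocentre_affix (c : circle) (X Y Z H : point) :
  on_circle c X -> on_circle c Y -> on_circle c Z ->
  X <> Y -> Y <> Z -> Z <> X -> is_orthocentre X Y Z H ->
  affix c H = (affix c X + affix c Y + affix c Z)%C.
Proof.
  intros HX HY HZ XY YZ ZX [H1 [H2 _]].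
  assert (sym : forall S T S' T', perpendicular S T S' T' -> perpendicular S' T' S T).
  { intros S T S' T' E; unfold perpendicular, dot in *. rewrite <- E. ring. }
  apply sym in H1; apply sym in H2.
  apply (perpendicular_chord c) in H1; [| assumption ..].
  apply (perpendicular_chord c) in H2; [| assumption ..].
  rewrite Cminus_conj in H1, H2.
  rewrite (conj_affix c X HX) in H1. rewrite (conj_affix c Y HY) in H2.
  pose proof (affix_neq_0 c X HX) as Hx. pose proof (affix_neq_0 c Y HY) as Hy.
  pose proof (radius2_neq_0 c) as Hk.
  assert (Hyx : (affix c Y - affix c X)%C <> 0%C).
  { intro E. apply XY. symmetry. apply (affix_inj c), Ceq_of_minus; exact E. }
  apply Ceq_minus in H1; apply Ceq_minus in H2. apply Ceq_of_minus.
  apply (Cmult_cancel (radius2 c * (affix c Y - affix c X))).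
  { apply Cmult_neq_0; assumption. }
  match type of H1 with ?e = _ => match type of H2 with ?f = _ =>
    transitivity (affix c Y * f - affix c X * e)%C; [field | rewrite H1, H2; ring]
  end end.
  split; assumption.
Qed.

(** * Rectangular hyperbolas *)

Lemma rectangular_semi (h : hyperbola) : rectangular h -> semi1 h = semi2 h.
Proof.
  intro H. pose proof (semi1_pos h). pose proof (semi2_pos h).
  pose proof (axis1_unit h) as Ue. pose proof (axis2_unit h) as Uf.
  unfold rectangular, perpendicular, asymptote_point1, asymptote_point2 in H.
  unfold dot, psub, padd, pscale in *; simpl in *.
  apply Rsqr_inj; [lra | lra |]. unfold Rsqr.
  set (a := semi1 h) in *. set (b := semi2 h) in *.
  set (e := axis1 h) in *. set (f := axis2 h) in *.
  replace (a * a) with (a * a * (fst e * fst e + snd e * snd e))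
    by (rewrite Ue; ring).
  replace (b * b) with (b * b * (fst f * fst f + snd f * snd f))
    by (rewrite Uf; ring).
  apply Rminus_diag_uniq. rewrite <- H. ring.
Qed.

(** The second axis is the first one turned by a right angle, in one of the two
    senses; the square does not see which. *)
Lemma orthonormal_sqr (e f m : point) :
  dot e e = 1 -> dot f f = 1 -> dot e f = 0 ->
  dot m f ^ 2 = (fst e * snd m - snd e * fst m) ^ 2.
Proof.
  destruct e as [e1 e2], f as [f1 f2], m as [m1 m2].
  unfold dot; simpl; intros He Hf Hef.
  (* [d] is the determinant of the frame: 1 or -1 according to its orientation. *)
  set (d := e1 * f2 - e2 * f1).
  assert (Hd : d * d = 1).
  { transitivity ((e1 * e1 + e2 * e2) * (f1 * f1 + f2 * f2)
                  - (e1 * f1 + e2 * f2) * (e1 * f1 + e2 * f2)).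
    - unfold d; ring.
    - rewrite He, Hf, Hef; ring. }
  assert (H1 : f1 = - d * e2).
  { transitivity ((e1 * e1 + e2 * e2) * f1 - e1 * (e1 * f1 + e2 * f2)).
    - rewrite He, Hef; ring.
    - unfold d; ring. }
  assert (H2 : f2 = d * e1).
  { transitivity ((e1 * e1 + e2 * e2) * f2 - e2 * (e1 * f1 + e2 * f2)).
    - rewrite He, Hef; ring.
    - unfold d; ring. }
  clearbody d. rewrite H1, H2.
  transitivity (d * d * ((e1 * m2 - e2 * m1) ^ 2)); [ring | rewrite Hd; simpl; ring].
Qed.

(** With equal semi-axes the equation in the frame is [x^2 - y^2 = semi1^2], and
    [x + i y] is [m * conj e] or its conjugate, according to the orientation of the
    frame; so [x^2 - y^2] is the real part of the square of [m * conj e]. *)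
Lemma on_rectangular_hyperbola (h : hyperbola) (X : point) :
  rectangular h -> on_hyperbola h X ->
  let e := axis1 h in let m := Cminus X (hcenter h) in
  (Cconj e * Cconj e * m * m + e * e * Cconj m * Cconj m
   = RtoC (2 * semi1 h ^ 2))%C.
Proof.
  intros HR HX e m.
  unfold on_hyperbola in HX. rewrite <- (rectangular_semi h HR) in HX.
  change (psub X (hcenter h)) with m in HX.
  rewrite (orthonormal_sqr (axis1 h) (axis2 h) m (axis1_unit h) (axis2_unit h)
             (axes_orthogonal h)) in HX.
  fold e in HX. clearbody m.
  assert (HS : dot m e ^ 2 - (fst e * snd m - snd e * fst m) ^ 2 = semi1 h ^ 2).
  { pose proof (semi1_pos h).
    replace (semi1 h ^ 2) with (1 * semi1 h ^ 2) by ring.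
    rewrite <- HX. field. lra. }
  rewrite <- HS. clearbody e. destruct e as [e1 e2], m as [m1 m2].
  unfold dot, Cconj, Cmult, Cplus, RtoC.
  apply injective_projections; simpl; ring.
Qed.

(** The shape that matters: the mixed term in [z * conj z] is absent, and the
    leading coefficient is nonzero. *)
Lemma rectangular_hyperbola_conic (h : hyperbola) (o : point) :
  rectangular h ->
  exists a a' b b' g : C, a <> 0%C /\
    forall X, on_hyperbola h X ->
      let z := Cminus X o in
      (a * z * z + a' * Cconj z * Cconj z + b * z + b' * Cconj z + g = 0)%C.
Proof.
  intro HR. set (e := axis1 h : C). set (w := Cminus o (hcenter h)).
  exists (Cconj e * Cconj e)%C, (e * e)%C,
    (* obtained by expanding [on_rectangular_hyperbola] at [z + w] *)
    (RtoC 2 * Cconj e * Cconj e * w)%C, (RtoC 2 * e * e * Cconj w)%C,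
    (Cconj e * Cconj e * w * w + e * e * Cconj w * Cconj w
     - RtoC (2 * semi1 h ^ 2))%C.
  split.
  - intro E. apply (RtoC_neq_0 1); [apply R1_neq_R0 |].
    assert (Hu : (e * Cconj e)%C = RtoC 1).
    { rewrite <- dot_self. unfold e. now rewrite axis1_unit. }
    rewrite <- (Cmult_1_l (RtoC 1)), <- Hu.
    transitivity (e * e * (Cconj e * Cconj e))%C; [ring | rewrite E; ring].
  - intros X HX z.
    rewrite <- (on_rectangular_hyperbola h X HR HX).
    replace (Cminus X (hcenter h)) with (z + w)%C by (unfold z, w; ring).
    fold e. rewrite Cplus_conj. ring.
Qed.

(** Divided differences at the roots lower the degree one step at a time: the last
    one gives [q], and the earlier ones then give [r], [s] and [t] in turn. *)
Lemma quartic_vieta (p q r s t a b c d : C) :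
  a <> b -> a <> c -> a <> d -> b <> c -> b <> d -> c <> d ->
  (forall z, z = a \/ z = b \/ z = c \/ z = d ->
     p * z * z * z * z + q * z * z * z + r * z * z + s * z + t = 0)%C ->
  (q = - (p * (a + b + c + d)) /\
   r = p * (a * b + a * c + a * d + b * c + b * d + c * d) /\
   s = - (p * (a * b * c + a * b * d + a * c * d + b * c * d)) /\
   t = p * (a * b * c * d))%C.
Proof.
  intros ab ac ad bc bd cd H.
  assert (Ha := H a (or_introl eq_refl)).
  assert (Hb := H b (or_intror (or_introl eq_refl))).
  assert (Hc := H c (or_intror (or_intror (or_introl eq_refl)))).
  assert (Hd := H d (or_intror (or_intror (or_intror eq_refl)))).
  clear H.
  assert (quot : forall x y u v e : C, x <> y -> u = 0%C -> v = 0%C ->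
            ((x - y) * e = u - v)%C -> e = 0%C).
  { intros x y u v e Hxy Hu Hv E.
    apply (Cmult_cancel (x - y)); [now apply Cminus_eq_contra |].
    rewrite E, Hu, Hv; ring. }
  set (D1 := fun x : C => (p * (a*a*a + a*a*x + a*x*x + x*x*x)
                       + q * (a*a + a*x + x*x) + r * (a + x) + s)%C).
  assert (D1b : D1 b = 0%C)
    by (apply (quot _ _ _ _ _ ab Ha Hb); unfold D1; ring).
  assert (D1c : D1 c = 0%C)
    by (apply (quot _ _ _ _ _ ac Ha Hc); unfold D1; ring).
  assert (D1d : D1 d = 0%C)
    by (apply (quot _ _ _ _ _ ad Ha Hd); unfold D1; ring).
  set (D2 := fun x : C => (p * (a*a + a*b + a*x + b*b + b*x + x*x)
                       + q * (a + b + x) + r)%C).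
  assert (D2c : D2 c = 0%C)
    by (apply (quot _ _ _ _ _ bc D1b D1c); unfold D1, D2; ring).
  assert (D2d : D2 d = 0%C)
    by (apply (quot _ _ _ _ _ bd D1b D1d); unfold D1, D2; ring).
  assert (Hq : (p * (a + b + c + d) + q)%C = 0%C)
    by (apply (quot _ _ _ _ _ cd D2c D2d); unfold D2; ring).
  assert (Eq : q = (- (p * (a + b + c + d)))%C)
    by (apply Ceq_of_minus; rewrite <- Hq; ring).
  assert (Er : r = (p * (a * b + a * c + a * d + b * c + b * d + c * d))%C)
    by (apply Ceq_of_minus; rewrite <- D2c; unfold D2; rewrite Eq; ring).
  assert (Es : s = (- (p * (a*b*c + a*b*d + a*c*d + b*c*d)))%C)
    by (apply Ceq_of_minus; rewrite <- D1b; unfold D1; rewrite Eq, Er; ring).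
  repeat split; try assumption.
  apply Ceq_of_minus; rewrite <- Ha, Eq, Er, Es; ring.
Qed.

(** Four points of a circle determine the rectangular hyperbola through them: with
    the conjugate replaced by [k / z], the equation of the hyperbola times [z^2] is
    a quartic vanishing at the four points, so its coefficients are the symmetric
    functions of these points up to the nonzero leading one. *)
Lemma rectangular_hyperbola_cyclic (c : circle) (h : hyperbola)
    (W X Y Z P : point) :
  rectangular h ->
  W <> X -> W <> Y -> W <> Z -> X <> Y -> X <> Z -> Y <> Z ->
  (forall U, U = W \/ U = X \/ U = Y \/ U = Z ->
     on_circle c U /\ on_hyperbola h U) ->
  on_hyperbola h P ->
  let k := radius2 c in let p := affix c P in
  let w := affix c W in let x := affix c X in
  let y := affix c Y in let z := affix c Z in
  (k * k * p * p + w * x * y * z * Cconj p * Cconj p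
   - k * k * (w + x + y + z) * p
   - k * (w * x * y + w * x * z + w * y * z + x * y * z) * Cconj p
   + k * k * (w * x + w * y + w * z + x * y + x * z + y * z) = 0)%C.
Proof.
  intros HR wx wy wz xy xz yz HU HP k p w x y z.
  destruct (rectangular_hyperbola_conic h (center c) HR)
    as [a [a' [b [b' [g [Ha Hc]]]]]].
  destruct (quartic_vieta a b g (b' * k) (a' * k * k) w x y z)
    as [Eb [Eg [Eb' Ea']]].
  1-6: intro E; apply affix_inj in E; contradiction.
  { intros u Hu.
    assert (HV : exists U, u = affix c U /\ on_circle c U /\ on_hyperbola h U).
    { destruct Hu as [-> | [-> | [-> | ->]]];
        [exists W | exists X | exists Y | exists Z];
        (split; [reflexivity | apply HU; tauto]). }
    destruct HV as [U [-> [HcU HhU]]].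
    specialize (Hc U HhU). cbv zeta in Hc. fold (affix c U) in Hc.
    rewrite (conj_affix c U HcU) in Hc. fold k in Hc.
    pose proof (affix_neq_0 c U HcU) as Hu0.
    transitivity (affix c U * affix c U * 0)%C; [| ring].
    rewrite <- Hc. field. exact Hu0. }
  specialize (Hc P HP). cbv zeta in Hc. fold (affix c P) in Hc. fold p in Hc.
  apply (Cmult_cancel a); [exact Ha |].
  transitivity (k * k * 0)%C; [| ring].
  rewrite <- Hc.
  transitivity (k * k * a * p * p + a' * k * k * Cconj p * Cconj p
                + k * k * b * p + k * (b' * k) * Cconj p + k * k * g)%C;
    [| ring].
  rewrite Eb, Eg, Eb', Ea'. ring.
Qed.

(** * The Steiner line *)

(** The line through the orthocentre [H] of [WYZ] and the reflection [R] of [X'] in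
    the side [YZ] is the Steiner line of [X'].  Its equation at [P] is, up to a
    nonzero factor, the equation of the hyperbola at [P]. *)
Lemma point_on_Steiner_line (c : circle) (h : hyperbola) (W X Y Z P X' R H : point) :
  rectangular h ->
  W <> X -> W <> Y -> W <> Z -> X <> Y -> X <> Z -> Y <> Z ->
  (forall U, U = W \/ U = X \/ U = Y \/ U = Z ->
     on_circle c U /\ on_hyperbola h U) ->
  on_hyperbola h P -> P <> X -> P <> H ->
  second_intersection c X P X' -> is_reflection Y Z X' R ->
  is_orthocentre W Y Z H ->
  line_through P H R.
Proof.
  intros HR wx wy wz xy xz yz HU HP PX PH HX' HRf HH.
  pose proof (rectangular_hyperbola_cyclic c h W X Y Z P HR wx wy wz xy xz yz
                HU HP) as Hyp.
  cbv zeta in Hyp.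
  destruct (HU W) as [cW _]; [tauto |]. destruct (HU X) as [cX _]; [tauto |].
  destruct (HU Y) as [cY _]; [tauto |]. destruct (HU Z) as [cZ _]; [tauto |].
  pose proof (second_intersection_chord c X P X' cX HX') as HC.
  assert (cX' : on_circle c X') by apply HX'.
  apply (reflection_chord c Y Z X' R cY cZ yz) in HRf.
  apply (orthocentre_affix c W Y Z H cW cY cZ wy yz (not_eq_sym wz)) in HH.
  rewrite (conj_affix c X' cX') in HRf.
  pose proof (affix_neq_0 c W cW) as w0. pose proof (affix_neq_0 c X cX) as x0.
  pose proof (affix_neq_0 c Y cY) as y0. pose proof (affix_neq_0 c Z cZ) as z0.
  pose proof (affix_neq_0 c X' cX') as x'0. pose proof (radius2_neq_0 c) as k0.
  (* The conjugate equation reads [k p / x = k], that is [P = X]. *)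
  assert (Hn : (affix c X * Cconj (affix c P) - radius2 c)%C <> 0%C).
  { intro E. apply PX, (affix_inj c), Ceq_of_minus.
    apply (f_equal Cconj) in E.
    rewrite Cminus_conj, Cmult_conj, Cconj_conj, (conj_affix c X cX) in E.
    unfold radius2 in E at 2. rewrite !Cconj_RtoC in E. fold (radius2 c) in E.
    apply (Cmult_cancel (radius2 c)); [exact k0 |].
    transitivity (affix c X * 0)%C; [| ring].
    rewrite <- E. field. exact x0. }
  (* the equation of the Steiner line of [X'], at [P] *)
  assert (HS : (radius2 c * affix c X' * (affix c P - affix c H)
                = affix c W * affix c Y * affix c Z * Cconj (affix c P)
                  - radius2 c * (affix c W * affix c Y + affix c W * affix c Z
                               + affix c Y * affix c Z))%C).
  { apply (Cmult_cancel _ _ _ Hn). apply Ceq_of_minus. rewrite HH.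
    apply Ceq_minus in HC.
    match type of HC with ?e = _ => match type of Hyp with ?f = _ =>
      transitivity (radius2 c * (affix c P - affix c W - affix c Y - affix c Z) * e
                    - f)%C;
        [ring | rewrite HC, Hyp; ring]
    end end. }
  assert (ER : affix c R
               = (affix c Y + affix c Z - affix c Y * affix c Z / affix c X')%C).
  { apply (Cmult_cancel (radius2 c)); [exact k0 |].
    apply Ceq_minus in HRf. apply Ceq_of_minus. rewrite <- HRf.
    field. exact x'0. }
  assert (HCR : (Cminus R H * Cconj (affix c P - affix c H)
                = Cconj (Cminus R H) * (affix c P - affix c H))%C).
  { replace (Cminus R H) with (affix c R - affix c H)%C by (unfold affix; ring).
    rewrite !Cminus_conj.
    assert (EH' : Cconj (affix c H)
                  = (radius2 c / affix c W + radius2 c / affix c Y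
                     + radius2 c / affix c Z)%C)
      by (rewrite HH, !Cplus_conj, !conj_affix by assumption; reflexivity).
    assert (ER' : Cconj (affix c R)
                  = (radius2 c / affix c Y + radius2 c / affix c Z
                     - radius2 c * affix c X' / (affix c Y * affix c Z))%C).
    { rewrite ER, Cminus_conj, Cplus_conj, Cdiv_conj, Cmult_conj by assumption.
      rewrite !conj_affix by assumption. field. repeat split; assumption. }
    rewrite EH', ER'. rewrite ER, HH. rewrite HH in HS.
    apply Ceq_minus in HS. apply Ceq_of_minus.
    (* [R - H] is [- (w x' + y z) / x'], so its product with the equation of the
       Steiner line, up to units, is the cross product sought. *)
    match type of HS with ?e = _ =>
      transitivity ((affix c W * affix c X' + affix c Y * affix c Z)
                    / (affix c X' * affix c W * affix c Y * affix c Z) * e)%C;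
      [field | rewrite HS; field]
    end; repeat split; assumption. }
  apply line_through_swap.
  apply line_through_of_real_ratio; [now apply not_eq_sym |].
  replace (Cminus P H) with (affix c P - affix c H)%C by (unfold affix; ring).
  exact HCR.
Qed.

(** * The eight points of a label *)

Lemma complete_labels (X k : label) :
  X <> k -> exists Y Z, NoDup (k :: X :: Y :: Z :: nil).
Proof.
  intro H.
  assert (no_dup : forall k X Y Z : label,
    k <> X -> k <> Y -> k <> Z -> X <> Y -> X <> Z -> Y <> Z ->
    NoDup (k :: X :: Y :: Z :: nil)).
  { intros. repeat constructor; simpl; intuition congruence. }
  destruct X, k; try contradiction;
    first [ exists lA, lB; apply no_dup; discriminate
          | exists lA, lC; apply no_dup; discriminate
          | exists lA, lD; apply no_dup; discriminate
          | exists lB, lC; apply no_dup; discriminate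
          | exists lB, lD; apply no_dup; discriminate
          | exists lC, lD; apply no_dup; discriminate ].
Qed.

(* [V X], [V' X] are the points X, X' of Gamma; [Q X k], [Q' X k] are X_k, X_k',
   where the triangle Delta_k is named by the label of the vertex it omits. *)
Theorem theorem2 :
  forall (V V' : label -> point) (Gamma : circle) (Sigma : hyperbola) (P : point)
         (Hagge : label -> circle) (Q Q' : label -> label -> point),
    (* A, B, C, D are distinct points of Gamma and of Sigma *)
    (forall X Y : label, X <> Y -> V X <> V Y) ->
    (forall X : label, on_circle Gamma (V X)) ->
    rectangular Sigma ->
    (forall X : label, on_hyperbola Sigma (V X)) ->
    (* A_1, B_2, C_3, D_4 are the orthocentres *)
    (forall k X Y Z : label, vertex_opposite k X Y Z ->
       is_orthocentre (V X) (V Y) (V Z) (Q k k)) ->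
    (* the point P *)
    on_hyperbola Sigma P ->
    (forall X : label, P <> V X) ->
    (forall k : label, P <> Q k k) ->
    (* A', B', C', D' *)
    (forall X : label, second_intersection Gamma (V X) P (V' X)) ->
    (* the reflections X_k' and the Hagge circle through them *)
    (forall k X Y Z : label, vertex_opposite k X Y Z ->
       is_reflection (V Y) (V Z) (V' X) (Q' X k)) ->
    (forall k X : label, X <> k -> on_circle (Hagge k) (Q' X k)) ->
    (* the remaining second intersections with the Hagge circles *)
    (forall k X : label, X <> k ->
       second_intersection (Hagge k) (Q' X k) P (Q X k)) ->
    (forall k : label, second_intersection (Hagge k) (Q k k) P (Q' k k)) ->
    forall X : label,
      collinear (fun Z : point => exists k : label, Z = Q X k \/ Z = Q' X k).
Proof.
  intros V V' Gamma Sigma P Hagge Q Q' HV HcV HR HhV HH HhP HPV HPQ HV' HQ' _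
    HQ HQk X.
  (* Both [k, X, Y, Z] and [X, k, Y, Z] enumerate the labels: [YZ] is the side
     opposite to [X] in the triangle [k] and opposite to [k] in the triangle [X]. *)
  assert (on_line : forall k, k <> X -> line_through P (Q X X) (Q' X k)).
  { intros k Hk. destruct (complete_labels X k (not_eq_sym Hk)) as [Y [Z HND]].
    assert (HND' : NoDup (X :: k :: Y :: Z :: nil)).
    { inversion_clear HND as [| ? ? N1 HND1]. inversion_clear HND1 as [| ? ? N2 HND2].
      simpl in N1, N2.
      constructor; [| constructor]; simpl; [tauto | tauto | exact HND2]. }
    assert (Hd : forall U T l1 l2 l3, NoDup (l1 ++ U :: l2 ++ T :: l3) ->
                 V U <> V T).
    { intros U T l1 l2 l3 N. apply HV. intros ->.
      apply NoDup_remove_2 in N. apply N.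
      rewrite !in_app_iff; simpl; tauto. }
    apply (point_on_Steiner_line Gamma Sigma (V k) (V X) (V Y) (V Z) P (V' X)).
    - exact HR.
    - exact (Hd k X nil nil (Y :: Z :: nil) HND).
    - exact (Hd k Y nil (X :: nil) (Z :: nil) HND).
    - exact (Hd k Z nil (X :: Y :: nil) nil HND).
    - exact (Hd X Y (k :: nil) nil (Z :: nil) HND).
    - exact (Hd X Z (k :: nil) (Y :: nil) nil HND).
    - exact (Hd Y Z (k :: X :: nil) nil nil HND).
    - intros U HU; destruct HU as [-> | [-> | [-> | ->]]]; auto.
    - exact HhP.
    - apply HPV.
    - apply HPQ.
    - apply HV'.
    - exact (HQ' k X Y Z HND).
    - exact (HH X k Y Z HND'). }
  exists P, (Q X X). split; [apply HPQ |].
  assert (label_eq : forall k : label, k = X \/ k <> X).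
  { intro k. destruct k, X; first [left; reflexivity | right; discriminate]. }
  intros Z [k Hk]. destruct (label_eq k) as [-> | HkX].
  - destruct Hk as [-> | ->].
    + apply line_through_C. exists 1. complex_ring.
    + apply line_through_swap. apply HQk.
  - destruct Hk as [-> | ->]; [| now apply on_line].
    apply (line_through_chain _ _ _ _ (on_line k HkX)).
    apply HQ. now apply not_eq_sym.
Qed.
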